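(* Let $(L,\vee,\wedge,0,1)$ be an $n$-element chain ($n\geq 1$). Then there are exactly $2^{n-1}$ derivations on $L$, and there are exactly $2^{n-1}$ isomorphic classes of derivations on $L$.
   Context: A derivation on a bounded lattice $L$ is a map $d:L\to L$ with $d(x\wedge y)=(d(x)\wedge y)\vee(x\wedge d(y))$ for all $x,y\in L$. Two derivations $d,d'$ on $L$ are isomorphic, written $d\cong d'$, if there is a lattice automorphism $f:L\to L$ with $f\circ d=d'\circ f$. This is an equivalence relation on the set of derivations on $L$, and its equivalence classes are called the isomorphic classes of derivations on $L$. *)

(* Defs.v *)
From HB Require Import structures.
From mathcomp Require Import all_boot all_order.

Set Implicit Arguments.
Unset Strict Implicit.
Unset Printing Implicit Defensive.

Import Order.Theory.

Section BoundedLattice.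
Context {disp : Order.disp_t} {L : tbLatticeType disp}.

Definition is_derivation (d : L -> L) : Prop :=
  forall x y : L, d (x `&` y)%O = ((d x `&` y) `|` (x `&` d y))%O.

Definition der_iso (d d' : L -> L) : Prop :=
  exists2 f : {lmorphism L -> L}, bijective f & f \o d =1 d' \o f.

Lemma lmorphism_of (f : L -> L) :
  Order.meet_morphism f -> Order.join_morphism f ->
  exists g : {lmorphism L -> L}, g = f :> (L -> L).
Proof.
move=> fI fU.
have f_homo : {homo f : x y / (x <= y)%O}.
  by move=> x y /meet_l xy; rewrite -xy fI leIr.
pose m0 := Order.isOrderMorphism.Build disp L disp L f f_homo.
pose F : {omorphism L -> L} := HB.pack f m0.
pose m := Order.isLatticeMorphism.Build disp L disp L F fI fU.
pose G : {lmorphism L -> L} := HB.pack (F : L -> L) F m.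
by exists G.
Qed.

Lemma der_iso_refl d : der_iso d d.
Proof. by exists (idfun : {lmorphism L -> L}) => //; exists id. Qed.

Lemma der_iso_sym d d' : der_iso d d' -> der_iso d' d.
Proof.
case=> f [g fK gK] hf.
have fI : {morph f : x y / (x `&` y)%O} := omorphI f.
have fU : {morph f : x y / (x `|` y)%O} := omorphU f.
have gI : Order.meet_morphism g.
  by move=> x y; apply: (can_inj fK); rewrite gK fI !gK.
have gU : Order.join_morphism g.
  by move=> x y; apply: (can_inj fK); rewrite gK fU !gK.
have [G eG] := lmorphism_of gI gU; exists G; rewrite eG; first by exists f.
by move=> x; apply: (can_inj fK); have /= -> := hf (g x); rewrite !gK.
Qed.

Lemma der_iso_trans d1 d2 d3 : der_iso d1 d2 -> der_iso d2 d3 -> der_iso d1 d3.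
Proof.
case=> f fb hf [g gb hg].
have hI : Order.meet_morphism (g \o f) by move=> x y; rewrite /= !omorphI.
have hU : Order.join_morphism (g \o f) by move=> x y; rewrite /= !omorphU.
have [h eh] := lmorphism_of hI hU; exists h; rewrite eh; first exact: bij_comp.
by move=> x /=; have /= -> := hf x; have /= -> := hg (f x).
Qed.

End BoundedLattice.

Section FiniteBoundedLattice.
Context {disp : Order.disp_t} {L : finTBLatticeType disp}.
Implicit Types d f : {ffun L -> L}.

(* Boolean counterparts of [is_derivation] and [der_iso], needed to form finite
   sets; [is_derivationP] and [der_isoP] show that they agree. *)
Definition is_derivationb d : bool :=
  [forall x : L, forall y : L,
     d (x `&` y)%O == ((d x `&` y) `|` (x `&` d y))%O].

Lemma is_derivationP d : reflect (is_derivation d) (is_derivationb d).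
Proof.
apply: (iffP forallP) => [h x y|h x]; first exact/eqP/(forallP (h x)).
by apply/forallP => y; apply/eqP.
Qed.

Definition lattice_automorphismb f : bool :=
  injectiveb f &&
  [forall x : L, forall y : L, (f (x `&` y)%O == (f x `&` f y)%O)
                            && (f (x `|` y)%O == (f x `|` f y)%O)].

Definition der_isob d d' : bool :=
  [exists f : {ffun L -> L},
     lattice_automorphismb f && [forall x : L, f (d x) == d' (f x)]].

Lemma der_isoP d d' : reflect (der_iso d d') (der_isob d d').
Proof.
apply: (iffP existsP) => [[f /andP[/andP[/injectiveP finj /forallP hf]]]|].
  move=> /forallP hd.
  have fI : Order.meet_morphism f.
    by move=> x y; case/andP: (forallP (hf x) y) => /eqP.
  have fU : Order.join_morphism f.
    by move=> x y; case/andP: (forallP (hf x) y) => _ /eqP.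
  have [F eF] := lmorphism_of fI fU; exists F; rewrite eF.
    exact: injF_bij.
  by move=> x /=; apply/eqP/hd.
case=> f fbij hf; exists [ffun x => f x]; apply/andP; split.
  apply/andP; split.
    by apply/injectiveP => x y; rewrite !ffunE; apply: (bij_inj fbij).
  apply/forallP => x; apply/forallP => y.
  by rewrite !ffunE omorphI omorphU !eqxx.
by apply/forallP => x; rewrite !ffunE; apply/eqP/(hf x).
Qed.

Lemma der_isob_equiv : equivalence_rel (fun d d' => der_isob d d').
Proof.
move=> d1 d2 d3; split; first by apply/der_isoP/der_iso_refl.
move=> /der_isoP h12; apply/der_isoP/der_isoP; apply: der_iso_trans => //.
exact: der_iso_sym.
Qed.

End FiniteBoundedLattice.

Definition derivations {disp : Order.disp_t} (L : finTBLatticeType disp) :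
    {set {ffun L -> L}} :=
  [set d | is_derivationb d].

Definition der_iso_classes {disp : Order.disp_t} (L : finTBLatticeType disp) :
    {set {set {ffun L -> L}}} :=
  equivalence_partition der_isob (derivations L).

(* Main.v *)
Require Import Defs.
From mathcomp Require Import all_boot all_order.

(** On a chain, [d] is a derivation iff [d x <= x] for all [x] and, whenever
    [x <= y], either [x <= d x] or [d y <= d x]
    ([is_derivation_chainP]).  This condition mentions only the order, so
    replacing every element by its rank turns the derivations of an [n]-element
    chain into sequences of [n] natural numbers satisfying the same condition
    ([derivation_seq]).

    Let [s] be such a sequence, of length [n + 2].  If its last value is [0],
    then [s] is an arbitrary derivation sequence of length [n + 1] followed by
    [0].  If its last value is positive, the condition forces every value except
    the first one to be positive, and [s] is [0] followed by an arbitrary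
    derivation sequence of length [n + 1] with all values increased by [1].
    Hence adding one element to the chain doubles the number of derivations
    ([mem_derivation_seqs], [size_derivation_seqs]), and a one-element chain
    has exactly one.

    A finite chain has no automorphism but the identity
    ([chain_automorphism_id]), so isomorphic derivations are equal and there are
    as many isomorphism classes as derivations. *)

Set Implicit Arguments.
Unset Strict Implicit.
Unset Printing Implicit Defensive.

Import Order.Theory.

Lemma is_derivation_chainP (disp : Order.disp_t) (L : tbOrderType disp)
    (d : L -> L) :
  is_derivation d <->
  (forall x y : L, (x <= y)%O ->
     (d x <= x)%O /\ ((x <= d x)%O || (d y <= d x)%O)).
Proof.
split=> [hd x y xy | hd].
  split.
    by have := hd x x; rewrite meetxx (meetC x) joinxx => ->; rewrite leIr.
  rewrite -leIx; have := hd x y; rewrite (meet_l xy) => ->.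
  exact: leUr.
have main x y : (x <= y)%O ->
    d (x `&` y)%O = ((d x `&` y) `|` (x `&` d y))%O.
  move=> xy; have [dx dxy] := hd x y xy.
  rewrite (meet_l xy) (meet_l (le_trans dx xy)) join_l //.
  by rewrite leIx.
move=> x y; have /orP[xy | yx] := le_total x y; first exact: main.
by rewrite meetC (main _ _ yx) joinC meetC (meetC (d y)).
Qed.

(** The condition of [is_derivation_chainP] for the map sending [i < size s] to
    the entry of index [i] of [s], on the chain of the [i < size s]. *)
Definition derivation_seq (s : seq nat) : Prop :=
  forall i j, i <= j < size s ->
    nth 0 s i <= i /\ ((i <= nth 0 s i) || (nth 0 s j <= nth 0 s i)).

Lemma derivation_seq_rcons0 s :
  derivation_seq (rcons s 0) <-> derivation_seq s.
Proof.
split=> hs i j /andP[ij].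
  move=> js; have := hs i j; rewrite ij size_rcons leqW // !nth_rcons js.
  by rewrite (leq_ltn_trans ij js); apply.
rewrite size_rcons ltnS !nth_rcons => js.
have [i_s | si] := ltnP i (size s); last first.
  by rewrite ltnNge (leq_trans si ij) !if_same /= leqnn orbT.
have [js' | _] := ltnP j (size s); first by apply: hs; rewrite ij.
rewrite if_same orbT; split=> //.
by have [] := hs i i; rewrite ?leqnn.
Qed.

Lemma derivation_seq_shift s :
  derivation_seq (0 :: map S s) <-> derivation_seq s.
Proof.
split=> hs i j /andP[ij].
  move=> js; have := hs i.+1 j.+1.
  rewrite /= size_map !ltnS ij js => /(_ isT).
  by rewrite !(nth_map 0) ?(leq_ltn_trans ij js).
case: i ij => [|i]; first by [].
case: j => [|j] //=; rewrite size_map !ltnS => ij js.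
rewrite !(nth_map 0) ?(leq_ltn_trans ij js) // !ltnS.
by apply: hs; rewrite ij.
Qed.

(** The derivation sequences of length [n.+1]. *)
Fixpoint derivation_seqs (n : nat) : seq (seq nat) :=
  if n is m.+1 then
    [seq rcons s 0 | s <- derivation_seqs m]
      ++ [seq 0 :: map S s | s <- derivation_seqs m]
  else [:: [:: 0]].

Lemma size_derivation_seqs n : size (derivation_seqs n) = 2 ^ n.
Proof.
elim: n => // n IHn.
by rewrite /= size_cat !size_map IHn addnn -mul2n -expnS.
Qed.

Lemma mem_derivation_seqs n s :
  s \in derivation_seqs n <-> size s = n.+1 /\ derivation_seq s.
Proof.
elim: n s => [|n IHn] s.
  rewrite mem_seq1; split=> [/eqP-> | [ss hs]].
    by split=> // i j /andP[]; case: i => [|i] //; case: j.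
  case: s ss hs => [|a []] //= _ hs.
  by have [/=] := hs 0 0 isT; rewrite leqn0 => /eqP->.
rewrite /= mem_cat; split.
  case/orP => /mapP[t /IHn[st ht] ->].
    by rewrite size_rcons st; split=> //; apply/derivation_seq_rcons0.
  by rewrite /= size_map st; split=> //; apply/derivation_seq_shift.
case=> ss hs; apply/orP.
have s0 : nth 0 s 0 = 0.
  by have [] := hs 0 0; rewrite ?ss // leqn0 => /eqP.
have [l0 | l0] := posnP (nth 0 s n.+1).
  left; case/lastP: s ss hs l0 {s0} => // t a.
  rewrite size_rcons => -[st] hs; rewrite nth_rcons st ltnn eqxx => a0.
  rewrite {}a0 in hs *; apply: map_f; apply/IHn; split=> //.
  exact/derivation_seq_rcons0.
right; case: s ss hs s0 l0 => // a t [st] hs /= a0 l0.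
rewrite {}a0 in hs *.
have tE : t = map S (map predn t).
  rewrite -map_comp -[LHS]map_id; apply/eq_in_map => x /(nthP 0)[i it <-] /=.
  rewrite prednK //.
  (* The entry of index [i.+1] in [0 :: t] is either at least [i.+1] or at
     least the last entry, which is positive. *)
  have [] := hs i.+1 n.+1; first by rewrite /= st ltnSn andbT -st.
  move=> _ /orP[] /=; first exact: leq_ltn_trans.
  exact: leq_trans.
rewrite tE; apply/map_f/IHn; split; first by rewrite size_map.
by apply/derivation_seq_shift; rewrite -tE.
Qed.

Lemma uniq_derivation_seqs n : uniq (derivation_seqs n).
Proof.
elim: n => //= n IHn; rewrite cat_uniq !map_inj_uniq ?IHn.
- (* The last entry tells the two families apart: it is [0] in the first one
     and positive in the second one. *)
  rewrite andbT /=; apply/hasPn => _ /mapP[s /mem_derivation_seqs[ss _] ->].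
  apply/mapP => -[t _ /(congr1 (last 0))].
  rewrite last_rcons /=; case/lastP: s ss => // s a _.
  by rewrite map_rcons last_rcons.
- by move=> s t [/inj_map]; apply; apply: succn_inj.
- by move=> s t; apply: rcons_injl.
Qed.

(** The sequence of the ranks of the values of [d], listed by increasing
    argument. *)
Definition rank_seq (disp : Order.disp_t) (L : finTBOrderType disp)
    (d : L -> L) : seq nat :=
  [seq val (Order.enum_rank (d (Order.enum_val i))) | i <- enum 'I_#|L|].

Section FiniteChain.
Variables (disp : Order.disp_t) (L : finTBOrderType disp).
Implicit Types d : {ffun L -> L}.

Lemma size_rank_seq (d : L -> L) : size (rank_seq d) = #|L|.
Proof. by rewrite size_map size_enum_ord. Qed.

Lemma nth_rank_seq (d : L -> L) (x : L) :
  nth 0 (rank_seq d) (Order.enum_rank x) = Order.enum_rank (d x).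
Proof.
rewrite (nth_map (Order.enum_rank x)) ?size_enum_ord ?ltn_ord //.
by rewrite nth_ord_enum Order.EnumVal.enum_rankK.
Qed.

Lemma rank_seq_inj : injective (fun d => rank_seq d).
Proof.
move=> d d' /= dd'; apply/ffunP => x.
apply: Order.EnumVal.enum_rank_inj; apply: val_inj.
by rewrite /= -(nth_rank_seq d) dd' nth_rank_seq.
Qed.

Lemma enum_rank_surj (k : nat) :
  k < #|L| -> exists x : L, k = Order.enum_rank x.
Proof.
move=> kL; exists (Order.enum_val (Ordinal kL)).
by rewrite Order.EnumVal.enum_valK.
Qed.

Lemma leq_enum_rank (x y : L) :
  (Order.enum_rank x <= Order.enum_rank y)%N = (x <= y)%O.
Proof. exact: (Order.EnumVal.le_enum_rank (@le_total _ L)). Qed.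

Lemma derivation_rank_seqP (d : L -> L) :
  is_derivation d <-> derivation_seq (rank_seq d).
Proof.
split=> [/is_derivation_chainP hd i j | hd]; last first.
  apply/is_derivation_chainP => x y xy.
  have := hd (Order.enum_rank x) (Order.enum_rank y).
  rewrite size_rank_seq ltn_ord !nth_rank_seq !leq_enum_rank xy.
  exact.
rewrite size_rank_seq => /andP[ij jL]; move: (ij).
have [x ->] := enum_rank_surj (leq_ltn_trans ij jL).
have [y ->] := enum_rank_surj jL.
by rewrite !nth_rank_seq !leq_enum_rank; apply: hd.
Qed.

Lemma rank_seq_surj (s : seq nat) :
  size s = #|L| -> derivation_seq s -> exists d, s = rank_seq d.
Proof.
move=> ss hs.
have lts (i : 'I_#|L|) : nth 0 s i < #|L|.
  apply: leq_ltn_trans (ltn_ord i).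
  by have [] := hs i i; rewrite ?leqnn ?ss ?ltn_ord.
exists [ffun x => Order.enum_val (Ordinal (lts (Order.enum_rank x)))].
apply: (@eq_from_nth _ 0) => [|i]; rewrite ?size_rank_seq // ss => iL.
have [x ->] := enum_rank_surj iL.
by rewrite nth_rank_seq ffunE Order.EnumVal.enum_valK.
Qed.

Lemma card_derivations : #|derivations L| = 2 ^ #|L|.-1.
Proof.
have L1 : #|L|.-1.+1 = #|L|.
  by apply: prednK; apply/card_gt0P; exists (\bot)%O.
rewrite -size_derivation_seqs cardE -(size_map (fun d => rank_seq d)).
apply/perm_size/uniq_perm.
- by rewrite map_inj_uniq ?enum_uniq //; apply: rank_seq_inj.
- exact: uniq_derivation_seqs.
move=> s; apply/mapP/idP => [[d] | /mem_derivation_seqs[]].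
  rewrite mem_enum inE => /is_derivationP/derivation_rank_seqP hd ->.
  by apply/mem_derivation_seqs; rewrite size_rank_seq L1.
rewrite L1 => ss hs; have [d sE] := rank_seq_surj ss hs.
exists d => //; rewrite mem_enum inE; apply/is_derivationP/derivation_rank_seqP.
by rewrite -sE.
Qed.

Lemma chain_automorphism_id (f : {ffun L -> L}) :
  lattice_automorphismb f -> f =1 id.
Proof.
case/andP=> /injectiveP finj /forallP hf.
have fmono : {homo f : x y / (x < y)%O}.
  move=> x y; rewrite !lt_neqAle (inj_eq finj) => /andP[-> /meet_l xy] /=.
  by have /andP[/eqP fI _] := forallP (hf x) y; rewrite -xy fI leIr.
(* The increasing enumeration of a finite chain is unique, and [f] maps it to
   an increasing enumeration. *)
pose e := sort <=%O (enum L).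
have es : sorted <%O e by rewrite sort_lt_sorted enum_uniq.
have ein x : x \in e by rewrite mem_sort mem_enum.
have /eq_in_map fe : map f e = map id e.
  rewrite map_id; apply: lt_sorted_eq => // [|x].
    exact: homo_sorted fmono _ es.
  rewrite ein; have [g _ gK] := injF_bij finj.
  by rewrite -[x]gK map_f.
by move=> x; apply: fe.
Qed.

Lemma der_isob_eq d d' : der_isob d d' = (d == d').
Proof.
apply/existsP/eqP => [[f /andP[/chain_automorphism_id fid /forallP h]] | ->].
  by apply/ffunP => x; have /eqP := h x; rewrite !fid.
exists [ffun x => x]; apply/andP; split; last first.
  by apply/forallP => x; rewrite !ffunE.
apply/andP; split; first by apply/injectiveP => x y; rewrite !ffunE.
by apply/forallP => x; apply/forallP => y; rewrite !ffunE !eqxx.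
Qed.

Lemma card_der_iso_classes : #|der_iso_classes L| = #|derivations L|.
Proof.
rewrite /der_iso_classes /equivalence_partition -[RHS](card_imset _ set1_inj).
congr #|pred_of_set _|; apply: eq_in_imset => d; rewrite inE => hd.
apply/setP => d'; rewrite in_set1 2!inE der_isob_eq eq_sym.
by case: eqP => [-> | _]; rewrite ?hd ?andbF.
Qed.

End FiniteChain.

Theorem theorem3p18 (disp : Order.disp_t) (L : finTBOrderType disp) (n : nat)
    (hn : 1 <= n) (hL : #|L| = n) :
  #|derivations L| = 2 ^ (n - 1) /\ #|der_iso_classes L| = 2 ^ (n - 1).
Proof. by rewrite card_der_iso_classes card_derivations hL subn1. Qed.
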